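(* Let $G$ be an internal abelian group. If $X$ is the one-point uniform space, then $H_p(X;G)\cong G$ for $p=0$ and $H_p(X;G)=0$ for $p\neq 0$.
   Context: Nonstandard setting: fix a standard universe $\mathbb{U}$ satisfying sufficiently many axioms of ZFC and containing all standard objects considered (uniform spaces are standard), and an elementary extension ${}^{\ast}\mathbb{U}$ of $\mathbb{U}$ (the internal universe) that is $|\mathbb{U}|^{+}$-saturated; $x\mapsto{}^{\ast}x$ is the elementary embedding. ''Internal'' means belonging to ${}^{\ast}\mathbb{U}$; ''hyperfinite'' means finite in the sense of ${}^{\ast}\mathbb{U}$. For a uniform space $X$, points $x,y\in{}^{\ast}X$ are infinitely close, $x\approx y$, if $(x,y)\in{}^{\ast}U$ for every entourage $U$ of $X$. $\mu$-homology: $C_p(X;G)$ is the internal abelian group of hyperfinite formal sums $\sum_{i=0}^{n}g_i\sigma_i$ with $\{g_i\}_{i=0}^n$ and $\{\sigma_i\}_{i=0}^n$ internal hyperfinite sequences in $G$ and in ${}^{\ast}X^{p+1}$ respectively (equivalently, internal functions ${}^{\ast}X^{p+1}\to G$ with hyperfinite support). A $p$-microsimplex is $(a_0,\ldots,a_p)\in{}^{\ast}X^{p+1}$ with $a_i\approx a_j$ for all $i,j\le p$. $M_p(X;G)\subseteq C_p(X;G)$ is the subgroup of $p$-microchains, i.e. elements representable as $\sum_{i=0}^n g_i\sigma_i$ with $\{g_i\}$, $\{\sigma_i\}$ internal hyperfinite sequences and every $\sigma_i$ a $p$-microsimplex; $M_p=0$ for $p<0$. The boundary $\partial_p:M_p(X;G)\to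 M_{p-1}(X;G)$ is the restriction of the internal homomorphism determined by $\partial_p(a_0,\ldots,a_p)=\sum_{i=0}^p(-1)^i(a_0,\ldots,\hat a_i,\ldots,a_p)$ ($\partial_0=0$). $H_\bullet(X;G)$ is the homology of the chain complex $M_\bullet(X;G)$. *)

(* Defs.v *)
From HB Require Import structures.
From mathcomp Require Import all_boot all_order all_algebra.
From mathcomp Require Import boolp classical_sets functions cardinality.

Set Implicit Arguments.
Unset Strict Implicit.
Unset Printing Implicit Defensive.

Import GRing.Theory.
Local Open Scope ring_scope.

Record memStruct := MemStruct {
  carrier :> Type;
  mem : carrier -> carrier -> Prop }.

Inductive formula :=
  | Mem of nat & nat
  | Eqv of nat & nat
  | Bot
  | And of formula & formula
  | Or of formula & formula
  | Imp of formula & formula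
  | All of formula
  | Ex of formula.

Definition scons (T : Type) (x : T) (v : nat -> T) (n : nat) : T :=
  if n is m.+1 then v m else x.

Fixpoint sat (M : memStruct) (v : nat -> M) (f : formula) : Prop :=
  match f with
  | Mem i j => mem (v i) (v j)
  | Eqv i j => v i = v j
  | Bot => False
  | And f g => sat v f /\ sat v g
  | Or f g => sat v f \/ sat v g
  | Imp f g => sat v f -> sat v g
  | All f => forall x, sat (scons x v) f
  | Ex f => exists x, sat (scons x v) f
  end.

Section Notions.
Context (M : memStruct).
Implicit Types a b c p r x y z n I : M.

Definition is_empty a := forall x, ~ mem x a.
Definition is_upair c a b := forall x, mem x c <-> x = a \/ x = b.
(* Kuratowski pair {{a}, {a, b}}. *)
Definition is_opair p a b := exists s, exists d,
  is_upair s a a /\ is_upair d a b /\ is_upair p s d.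
Definition related r x y := exists p, is_opair p x y /\ mem p r.
Definition is_succ b a := forall x, mem x b <-> mem x a \/ x = a.
Definition inductive I :=
  (exists e, is_empty e /\ mem e I) /\
  forall x, mem x I -> exists y, is_succ y x /\ mem y I.
Definition is_nat n := forall I, inductive I -> mem n I.

(* The tuple (a_0, ..., a_k) is coded by the set (a_0, (a_1, ... (a_k, 0))). *)
Fixpoint seq_code (s : seq M) c : Prop :=
  if s is a :: s' then exists d, seq_code s' d /\ is_opair c a d
  else is_empty c.

End Notions.

(* Zermelo set theory: the fragment of ZFC required of the standard universe. *)
Record zermelo (M : memStruct) : Prop := {
  z_ext : forall a b : M, (forall x, mem x a <-> mem x b) -> a = b;
  z_pair : forall a b : M, exists c, is_upair c a b;
  z_union : forall a : M, exists b, forall x,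
    mem x b <-> exists y, mem y a /\ mem x y;
  z_power : forall a : M, exists b, forall x,
    mem x b <-> forall z, mem z x -> mem z a;
  z_infinity : exists I : M, inductive I;
  z_separation : forall (f : formula) (v : nat -> M) (a : M),
    exists b, forall x, mem x b <-> mem x a /\ sat (scons x v) f }.

Definition elementary (U V : memStruct) (j : U -> V) :=
  forall (f : formula) (v : nat -> U), sat v f <-> sat (j \o v) f.

(* |U|^+-saturation of V: every finitely satisfiable set of formulas in the
   variable 0, with parameters from a set of cardinality at most |U|, is
   satisfied by one element. *)
Definition saturated (U V : memStruct) :=
  forall A : set V, (A #<= [set: U])%card ->
  forall S : set (formula * (nat -> V)),
    (forall q, S q -> forall n, A (q.2 n)) ->
    (forall F, finite_set F -> (F `<=` S)%classic ->
       exists x, forall q, F q -> sat (scons x q.2) q.1) ->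
    exists x, forall q, S q -> sat (scons x q.2) q.1.

Record nsUniverse := NsUniverse {
  std : memStruct;
  nst : memStruct;
  star : std -> nst;
  std_zermelo : zermelo std;
  star_elementary : elementary star;
  nst_saturated : saturated std nst }.

Record uniformSpace (M : memStruct) := UniformSpace {
  points : M;
  entourages : M;
  ent_nonempty : exists E, mem E entourages;
  ent_sub : forall E, mem E entourages -> forall p, mem p E ->
    exists x y, [/\ mem x points, mem y points & is_opair p x y];
  ent_diag : forall E, mem E entourages -> forall x, mem x points ->
    related E x x;
  ent_up : forall E F, mem E entourages ->
    (forall p, mem p F ->
       exists x y, [/\ mem x points, mem y points & is_opair p x y]) ->
    (forall p, mem p E -> mem p F) -> mem F entourages;
  ent_inter : forall E F, mem E entourages -> mem F entourages ->
    exists D, mem D entourages /\ forall p, mem p D <-> mem p E /\ mem p F;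
  ent_inv : forall E, mem E entourages -> exists D, mem D entourages /\
    forall x y, related D x y -> related E y x;
  ent_comp : forall E, mem E entourages -> exists D, mem D entourages /\
    forall x y z, related D x y -> related D y z -> related E x z }.

Definition one_point (M : memStruct) (X : uniformSpace M) :=
  exists a, forall x, mem x (points X) <-> x = a.

Record El (M : memStruct) (A : M) := MkEl { elval : M; elvalP : mem elval A }.

HB.instance Definition _ (M : memStruct) (A : M) := gen_eqMixin (El A).
HB.instance Definition _ (M : memStruct) (A : M) := gen_choiceMixin (El A).

Lemma elval_inj (M : memStruct) (A : M) : injective (@elval M A).
Proof.
by case=> x hx [y hy] /= e; case: _ / e hy => hy; congr MkEl; exact: Prop_irrelevance.
Qed.

(* A coding [c : T -> M -> Prop] says which sets of M represent the elements
   of T. The function f is coded by the set F when F is its graph. *)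
Definition el_code (M : memStruct) (A : M) (x : El A) (c : M) := c = elval x.

Definition tuple_code (M : memStruct) (A : M) (n : nat)
  (t : n.-tuple (El A)) (c : M) := seq_code (map (@elval M A) t) c.

Definition graph_code (M : memStruct) (S T : Type) (cS : S -> M -> Prop)
    (cT : T -> M -> Prop) (f : S -> T) (F : M) :=
  (forall s, exists x y, [/\ cS s x, cT (f s) y & related F x y]) /\
  (forall p, mem p F ->
     exists s x y, [/\ cS s x, cT (f s) y & is_opair p x y]).

Definition internal (M : memStruct) (S T : Type) (cS : S -> M -> Prop)
    (cT : T -> M -> Prop) (f : S -> T) := exists F, graph_code cS cT f F.

Definition apply2 (M : memStruct) (op x y z : M) :=
  exists p, is_opair p x y /\ related op p z.

(* (gset, gop) is an abelian group in the sense of M. *)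
Record intAbGroup (M : memStruct) := IntAbGroup {
  gset : M;
  gop : M;
  gop_sub : forall t, mem t gop -> exists p x y z,
    [/\ mem x gset, mem y gset, mem z gset, is_opair p x y & is_opair t p z];
  gop_total : forall x y, mem x gset -> mem y gset ->
    exists z, mem z gset /\ apply2 gop x y z;
  gop_fun : forall x y z z', apply2 gop x y z -> apply2 gop x y z' -> z = z';
  gop_assoc : forall x y z u v w, apply2 gop x y u -> apply2 gop u z w ->
    apply2 gop y z v -> apply2 gop x v w;
  gop_comm : forall x y z, apply2 gop x y z -> apply2 gop y x z;
  gop_zero_inv : exists e, [/\ mem e gset,
    forall x, mem x gset -> apply2 gop e x x &
    forall x, mem x gset -> exists y, mem y gset /\ apply2 gop y x e] }.

Section GroupElements.
Context (M : memStruct) (G : intAbGroup M).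

Definition gelt := El (gset G).
HB.instance Definition _ := Choice.on gelt.

Lemma gplus_ex (x y : gelt) :
  exists z : gelt, apply2 (gop G) (elval x) (elval y) (elval z).
Proof.
by have [z [zG h]] := gop_total (elvalP x) (elvalP y); exists (MkEl zG).
Qed.

Definition gplus x y : gelt := projT1 (cid (gplus_ex x y)).
Lemma gplusP x y : apply2 (gop G) (elval x) (elval y) (elval (gplus x y)).
Proof. exact: (projT2 (cid (gplus_ex x y))). Qed.
Lemma gplusE x y z : apply2 (gop G) (elval x) (elval y) (elval z) -> gplus x y = z.
Proof. by move=> h; apply: elval_inj; exact: gop_fun (gplusP x y) h. Qed.

Definition gzero_ex := cid (gop_zero_inv G).
Definition gzero : gelt :=
  MkEl (let: And3 h _ _ := projT2 gzero_ex in h).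

Lemma gopp_ex (x : gelt) :
  exists y : gelt, apply2 (gop G) (elval y) (elval x) (elval gzero).
Proof.
rewrite /gzero /=; case: gzero_ex => e [h0 h1 h2] /=.
by have [y [yG h]] := h2 _ (elvalP x); exists (MkEl yG).
Qed.
Definition gopp x : gelt := projT1 (cid (gopp_ex x)).

Fact gplusA : associative gplus.
Proof.
move=> x y z; apply: gplusE.
exact: gop_assoc (gplusP x y) (gplusP _ z) (gplusP y z).
Qed.
Fact gplusC : commutative gplus.
Proof. by move=> x y; apply: gplusE; apply: gop_comm; exact: gplusP. Qed.
Fact gplus0 : left_id gzero gplus.
Proof.
move=> x; apply: gplusE; rewrite /gzero /=; case: gzero_ex => e [h0 h1 h2] /=.
exact: h1 (elvalP x).
Qed.
Fact gplusN : left_inverse gzero gopp gplus.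
Proof. by move=> x; apply: gplusE; exact: (projT2 (cid (gopp_ex x))). Qed.

HB.instance Definition _ := GRing.isZmodule.Build gelt gplusA gplusC gplus0 gplusN.

End GroupElements.

Section FormalSums.
Context (M : memStruct) (X : M) (G : intAbGroup M).

Definition simplex (p : nat) := p.+1.-tuple (El X).

Definition face (p : nat) (i : 'I_p.+2) (s : simplex p.+1) : simplex p :=
  [tuple tnth s (lift i j) | j < p.+1].

(* A formal sum of p-simplices is identified with the function giving the
   coefficient of each simplex. *)
Definition single (p : nat) (g : gelt G) (s : simplex p) : simplex p -> gelt G :=
  fun t => if t == s then g else 0.

Definition gelt_code (g : gelt G) (c : M) := el_code g c.
Definition simplex_code (p : nat) (s : simplex p) (c : M) := tuple_code s c.
Definition chain_code (p : nat) (f : simplex p -> gelt G) (F : M) :=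
  graph_code (@simplex_code p) gelt_code f F.

(* f = \sum_(i < n) g_i s_i, where n is a natural number of M, that is
   n = {0, ..., n - 1}: there is an internal sequence t_0, ..., t_n of partial
   sums with t_0 = 0, t_(i+1) = t_i + g_i s_i and t_n = f. *)
Definition formal_sum (p : nat) (n : M) (g : El n -> gelt G)
    (s : El n -> simplex p) (f : simplex p -> gelt G) :=
  exists m, is_succ m n /\
  exists t : El m -> simplex p -> gelt G,
  [/\ internal (@el_code M m) (@chain_code p) t,
      forall k, is_empty (elval k) -> t k = 0,
      forall (i : El n) (k k' : El m), elval k = elval i ->
        is_succ (elval k') (elval i) -> t k' = t k + single (g i) (s i) &
      forall k, elval k = n -> t k = f].

(* Sums of the form \sum_(i < n) g_i s_i with n hyperfinite, (g_i) and (s_i)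
   internal, and all s_i in P. *)
Definition chains (p : nat) (P : simplex p -> Prop) (f : simplex p -> gelt G) :=
  exists n, is_nat n /\
  exists (g : El n -> gelt G) (s : El n -> simplex p),
  [/\ internal (@el_code M n) gelt_code g,
      internal (@el_code M n) (@simplex_code p) s,
      forall i, P (s i) & formal_sum g s f].

End FormalSums.

Fixpoint ren (r : nat -> nat) (f : formula) : formula :=
  let up n := if n is m.+1 then (r m).+1 else 0%N in
  match f with
  | Mem i j => Mem (r i) (r j)
  | Eqv i j => Eqv (r i) (r j)
  | Bot => Bot
  | And f g => And (ren r f) (ren r g)
  | Or f g => Or (ren r f) (ren r g)
  | Imp f g => Imp (ren r f) (ren r g)
  | All f => All (ren up f)
  | Ex f => Ex (ren up f)
  end.

Lemma sat_ren (M : memStruct) f r (v : nat -> M) :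
  sat v (ren r f) <-> sat (v \o r) f.
Proof.
have upE r0 (v0 : nat -> M) x :
    scons x v0 \o (fun n => if n is m.+1 then (r0 m).+1 else 0%N) =
    scons x (v0 \o r0) by apply/funext => -[].
elim: f r v => //=.
- by move=> f IHf g IHg r v; rewrite IHf IHg.
- by move=> f IHf g IHg r v; rewrite IHf IHg.
- by move=> f IHf g IHg r v; rewrite IHf IHg.
- by move=> f IHf r v; split=> h x; have := h x; rewrite IHf upE.
- by move=> f IHf r v; split=> -[x h]; exists x; move: h; rewrite IHf upE.
Qed.

Fixpoint bound (f : formula) : nat :=
  match f with
  | Mem i j | Eqv i j => maxn i.+1 j.+1
  | Bot => 0
  | And f g | Or f g | Imp f g => maxn (bound f) (bound g)
  | All f | Ex f => (bound f).-1
  end.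

Lemma sat_bound (M : memStruct) f (v w : nat -> M) :
  (forall n, (n < bound f)%N -> v n = w n) -> sat v f <-> sat w f.
Proof.
elim: f v w => //=.
- by move=> i j v w h; rewrite !h // leq_max ltnSn ?orbT.
- by move=> i j v w h; rewrite !h // leq_max ltnSn ?orbT.
1-3: by move=> f IHf g IHg v w h;
  rewrite (IHf v w) ?(IHg v w) // => n hn; apply: h; rewrite leq_max hn ?orbT.
- move=> f IHf v w h; split=> H x; have := H x; rewrite (IHf _ (scons x w)) //;
    by case=> //= n hn; rewrite h // -ltnS (ltn_predK hn).
- move=> f IHf v w h; split=> -[x H]; exists x; move: H;
    rewrite (IHf _ (scons x w)) //;
    by case=> //= n hn; rewrite h // -ltnS (ltn_predK hn).
Qed.

Lemma sat_iter_All (M : memStruct) k f (w : nat -> M) :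
  sat w (iter k All f) <->
  forall v : nat -> M, sat (fun n => if (n < k)%N then v n else w (n - k)%N) f.
Proof.
elim: k w f => [|k IHk] w f.
  have e (v : nat -> M) : (fun n => if (n < 0)%N then v n else w (n - 0)%N) = w.
    by apply/funext => n; rewrite ltn0 subn0.
  by split=> [h v|/(_ w)]; rewrite e.
rewrite iterS; split=> [h v|h x].
- have /IHk /(_ v) := h (v k); congr sat; apply/funext => n.
  rewrite ltnS (leq_eqVlt n k); have [nk|nk|->] := ltngtP n k => //=.
    by rewrite -(subnSK nk).
  by rewrite subnn.
- apply/IHk => v.
  have := h (fun n => if (n < k)%N then v n else x); congr sat.
  apply/funext => n; rewrite ltnS (leq_eqVlt n k).
  have [nk|nk|->] := ltngtP n k => //=; first by rewrite -(subnSK nk).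
  by rewrite subnn.
Qed.

(* Elementary embeddings transfer universally closed formulas. *)
Lemma transfer (U V : memStruct) (j : U -> V) f : elementary j -> U ->
  (forall v : nat -> U, sat v f) -> forall v : nat -> V, sat v f.
Proof.
move=> hj u hU v.
have : sat (j \o (fun _ => u)) (iter (bound f) All f).
  by apply/hj/sat_iter_All.
move=> /sat_iter_All /(_ v); apply: iffLR; apply: sat_bound => n hn.
by rewrite hn.
Qed.

Definition Iff f g := And (Imp f g) (Imp g f).

Lemma zermelo_transfer (U V : memStruct) (j : U -> V) :
  elementary j -> zermelo U -> zermelo V.
Proof.
move=> hj zU; have [u _] := z_infinity zU.
have T f := transfer (f := f) hj u.
split.
- move=> a b.
  have := T (Imp (All (Iff (Mem 0 1) (Mem 0 2))) (Eqv 0 1)) _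
    (scons a (scons b (fun _ => a))).
  by apply=> v; exact: (z_ext zU).
- move=> a b.
  have := T (Ex (All (Iff (Mem 0 1) (Or (Eqv 0 2) (Eqv 0 3))))) _
    (scons a (scons b (fun _ => a))).
  by apply=> v; exact: (z_pair zU).
- move=> a.
  have := T (Ex (All (Iff (Mem 0 1) (Ex (And (Mem 0 3) (Mem 1 0)))))) _
    (scons a (fun _ => a)).
  by apply=> v; exact: (z_union zU).
- move=> a.
  have := T (Ex (All (Iff (Mem 0 1) (All (Imp (Mem 0 1) (Mem 0 3)))))) _
    (scons a (fun _ => a)).
  by apply=> v; exact: (z_power zU).
- have := T (Ex (And (Ex (And (All (Imp (Mem 0 1) Bot)) (Mem 0 1)))
    (All (Imp (Mem 0 1) (Ex (And
      (All (Iff (Mem 0 1) (Or (Mem 0 2) (Eqv 0 2)))) (Mem 0 2))))))) _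
    (fun _ => j u).
  by apply=> v; exact: (z_infinity zU).
- move=> f v a.
  pose r n := if n is m.+1 then m.+3 else 0%N.
  have rE (W : memStruct) (b x : W) (w : nat -> W) :
      scons x (scons b w) \o r = scons x (w \o S).
    by apply/funext => -[].
  have := T (Ex (All (Iff (Mem 0 1) (And (Mem 0 2) (ren r f))))) _ (scons a v).
  have e (W : memStruct) (b x : W) (w : nat -> W) :
      sat (scons x (scons b w)) (ren r f) <-> sat (scons x (w \o S)) f.
    by rewrite sat_ren rE.
  case=> [w|b hb].
    have [b hb] := z_separation zU f (w \o S) (w 0%N).
    exists b => x.
    exact: (iff_trans (hb x) (and_iff_compat_l _ (iff_sym (e _ _ _ _)))).
  exists b => x; exact: (iff_trans (hb x) (and_iff_compat_l _ (e _ _ _ _))).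
Qed.

Section Definability.
Context (M : memStruct).
Implicit Types (P Q : (nat -> M) -> Prop) (t s : (nat -> M) -> M).

Definition inter (v e : nat -> M) (n : nat) : M :=
  if odd n then e n./2 else v n./2.

(* P is first-order definable with parameters. *)
Definition definable P := exists f e, forall v, P v <-> sat (inter v e) f.

Definition is_term t := exists k e, forall v, t v = inter v e k.

Lemma term_var k : M -> is_term (fun v => v k).
Proof.
by move=> c; exists k.*2, (fun=> c) => v; rewrite /inter odd_double doubleK.
Qed.

Lemma term_cst (c : M) : is_term (fun=> c).
Proof. by exists 1%N, (fun=> c). Qed.

Let r1 n := if odd n then (n./2).*2.*2.+1 else n.
Let r2 n := if odd n then (n./2).*2.+1.*2.+1 else n.
Let inter1 v e e' : inter v (inter e e') \o r1 = inter v e.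
Proof.
apply/funext => n; rewrite /= /inter /r1; case: (boolP (odd n)) => /= [_|/negbTE->//].
by rewrite /= odd_double /= uphalf_double odd_double doubleK.
Qed.
Let inter2 v e e' : inter v (inter e e') \o r2 = inter v e'.
Proof.
apply/funext => n; rewrite /= /inter /r2; case: (boolP (odd n)) => /= [_|/negbTE->//].
by rewrite /= odd_double /= uphalf_double /= odd_double /= uphalf_double.
Qed.

Lemma definable_mem t s : is_term t -> is_term s ->
  definable (fun v => mem (t v) (s v)).
Proof.
move=> [k [e ht]] [l [e' hs]]; exists (Mem (r1 k) (r2 l)), (inter e e') => v /=.
by rewrite ht hs -(inter1 v e e') -(inter2 v e e').
Qed.

Lemma definable_eq t s : is_term t -> is_term s ->
  definable (fun v => t v = s v).
Proof.
move=> [k [e ht]] [l [e' hs]]; exists (Eqv (r1 k) (r2 l)), (inter e e') => v /=.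
by rewrite ht hs -(inter1 v e e') -(inter2 v e e').
Qed.

Lemma definable_cst (A : Prop) : M -> definable (fun=> A).
Proof.
move=> c; have [a|na] := pselect A.
  by exists (Imp Bot Bot), (fun=> c) => v /=; split.
by exists Bot, (fun=> c).
Qed.

Lemma definable_and P Q : definable P -> definable Q ->
  definable (fun v => P v /\ Q v).
Proof.
move=> [f [e hP]] [g [e' hQ]].
exists (And (ren r1 f) (ren r2 g)), (inter e e') => v /=.
by rewrite !sat_ren inter1 inter2 hP hQ.
Qed.

Lemma definable_or P Q : definable P -> definable Q ->
  definable (fun v => P v \/ Q v).
Proof.
move=> [f [e hP]] [g [e' hQ]].
exists (Or (ren r1 f) (ren r2 g)), (inter e e') => v /=.
by rewrite !sat_ren inter1 inter2 hP hQ.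
Qed.

Lemma definable_imp P Q : definable P -> definable Q ->
  definable (fun v => P v -> Q v).
Proof.
move=> [f [e hP]] [g [e' hQ]].
exists (Imp (ren r1 f) (ren r2 g)), (inter e e') => v /=.
by rewrite !sat_ren inter1 inter2 hP hQ.
Qed.

Lemma definable_not P : definable P -> definable (fun v => ~ P v).
Proof. by move=> [f [e hP]]; exists (Imp f Bot), e => v /=; rewrite hP. Qed.

Lemma definable_iff P Q : definable P -> definable Q ->
  definable (fun v => P v <-> Q v).
Proof.
by move=> hP hQ; apply: definable_and; apply: definable_imp.
Qed.

Lemma definable_subst (r : nat -> nat) P : definable P ->
  definable (fun v => P (v \o r)).
Proof.
move=> [f [e h]]; exists (ren (fun n => if odd n then n else (r n./2).*2) f), e.
move=> v; rewrite sat_ren (h (v \o r)).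
suff -> : inter (v \o r) e =
  inter v e \o (fun n => if odd n then n else (r n./2).*2) by [].
apply/funext => n; rewrite /= /inter; case: (boolP (odd n)) => /= [->//|_].
by rewrite odd_double doubleK.
Qed.

Let r3 n := if odd n then n.+1 else n.-1.
Let inter3 x v e : scons x (inter v e) \o r3 = inter (scons x v) e.
Proof.
apply/funext => n; rewrite /= /inter /r3.
case: (boolP (odd n)) => [on|] /=; first by rewrite on.
case: n => [//|n] /=; rewrite negbK => on.
case: n on => // n /=.
by move=> on; rewrite (negbTE on).
Qed.

Lemma definable_all (R : (nat -> M) -> M -> Prop) :
  definable (fun v => R (fun n => v n.+1) (v 0%N)) ->
  definable (fun v => forall x, R v x).
Proof.
move=> [f [e h]]; exists (All (ren r3 f)), e => v /=.
split=> H x; first by rewrite sat_ren inter3; apply/h; exact: H.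
by have := H x; rewrite sat_ren inter3 => /h.
Qed.

Lemma definable_ex (R : (nat -> M) -> M -> Prop) :
  definable (fun v => R (fun n => v n.+1) (v 0%N)) ->
  definable (fun v => exists x, R v x).
Proof.
move=> [f [e h]]; exists (Ex (ren r3 f)), e => v /=.
split=> -[x H]; exists x; first by rewrite sat_ren inter3; apply/h; exact: H.
by move: H; rewrite sat_ren inter3 => /h.
Qed.

End Definability.

Ltac definable_term :=
  match goal with c : carrier _ |- _ =>
    first [ exact: (@term_var _ _ c) | exact: term_cst ] end.

Ltac definable :=
  cbv beta; match goal with
  | c : carrier ?M |- @definable ?M _ => first
    [ exact: (@definable_cst _ _ c)
    | apply: definable_mem; definable_term
    | apply: definable_eq; definable_term
    | apply: definable_and; definable
    | apply: definable_or; definable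
    | apply: definable_not; definable
    | apply: definable_imp; definable
    | apply: definable_ex; definable
    | apply: definable_all; definable ]
  end.
Ltac undefinable := rewrite /is_nat /inductive /apply2 /related /is_opair /is_upair /is_succ /is_empty.

Section Zermelo.
Context (M : memStruct) (zM : zermelo M).
Implicit Types a b c x y z n F A : M.

Lemma separation (P : M -> Prop) a : definable (fun v => P (v 0%N)) ->
  exists b, forall x, mem x b <-> mem x a /\ P x.
Proof.
move=> [f [e h]].
have [b hb] := z_separation zM f (fun k => inter (fun=> a) e k.+1) a.
exists b => x; rewrite hb (h (scons x (fun=> a))).
suff -> : inter (scons x (fun=> a)) e =
  scons x (fun k => inter (fun=> a) e k.+1) by [].
apply/funext => -[|n] //=; rewrite /inter /=.
by case: n => //= n; case: ifP => //.
Qed.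

Lemma ex_empty : exists e : M, is_empty e.
Proof. by have [I [[e [he _]] _]] := z_infinity zM; exists e. Qed.

Lemma ex_adjoin a x : exists b, forall y, mem y b <-> mem y a \/ y = x.
Proof.
have [s hs] := z_pair zM x x; have [p hp] := z_pair zM a s.
have [b hb] := z_union zM p; exists b => y; rewrite hb; split.
  by move=> [z [/hp[->|->]]]; [left|move=> /hs[]; right].
move=> [h|->]; [exists a|exists s]; split=> //; try by apply/hp; tauto.
by apply/hs; left.
Qed.

Lemma ex_opair x y : exists p, is_opair p x y.
Proof.
have [s hs] := z_pair zM x x; have [d hd] := z_pair zM x y.
by have [p hp] := z_pair zM s d; exists p, s, d.
Qed.

Lemma upair_l c x y : is_upair c x y -> mem x c. Proof. by move->; left. Qed.
Lemma upair_r c x y : is_upair c x y -> mem y c. Proof. by move->; right. Qed.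

Lemma opair_inj p x y x' y' : is_opair p x y -> is_opair p x' y' ->
  x = x' /\ y = y'.
Proof.
suff core a b a' b' : is_opair p a b -> is_opair p a' b' -> a' = a /\
    (b' = a \/ b' = b).
  move=> h h'; have [e eb'] := core _ _ _ _ h h'.
  have [_ eb] := core _ _ _ _ h' h; subst x'; split=> //.
  by case: eb' => // eb'; subst y'; case: eb.
move=> [s [d [hs [hd hp]]]] [s' [d' [hs' [hd' hp']]]].
have e : a' = a.
  have : mem s p by apply: upair_l hp.
  by case/hp' => e; subst s; [have /hs[] := upair_l hs'|have /hs[] := upair_l hd'].
split=> //; have : mem d' p by apply: upair_r hp'.
case/hp => e'; subst d'; first by have /hs[] := upair_r hd'; left.
by have /hd := upair_r hd'.
Qed.

Lemma opair_ext p q x y : is_opair p x y -> is_opair q x y -> p = q.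
Proof.
have uext c c' u v : is_upair c u v -> is_upair c' u v -> c = c'.
  by move=> h h'; apply: (z_ext zM) => w; rewrite h h'.
move=> [s [d [hs [hd hp]]]] [s' [d' [hs' [hd' hp']]]].
by move: hp'; rewrite -(uext _ _ _ _ hs hs') -(uext _ _ _ _ hd hd'); exact: uext.
Qed.

Lemma ex_product a b : exists c, forall x y p,
  mem x a -> mem y b -> is_opair p x y -> mem p c.
Proof.
have [q hq] := z_pair zM a b; have [u hu] := z_union zM q.
have [w hw] := z_power zM u; have [c hc] := z_power zM w.
exists c => x y p xa yb [s [d [hs [hd hp]]]].
have xu : mem x u by apply/hu; exists a; split=> //; exact: upair_l hq.
have yu : mem y u by apply/hu; exists b; split=> //; exact: upair_r hq.
by apply/hc => z /hp[] ->; apply/hw => v; [move/hs=> []->|move/hd=> []->].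
Qed.

Lemma ex_graph (W Z : M) (R : M -> M -> Prop) :
  definable (fun v => R (v 0%N) (v 1%N)) ->
  exists F, forall p, mem p F <->
    exists x y, [/\ mem x W, mem y Z, R x y & is_opair p x y].
Proof.
move=> hR; have [c hc] := ex_product W Z.
have [|F hF] := @separation (fun p => exists x y,
  mem x W /\ mem y Z /\ is_opair p x y /\ R x y) c.
  do 2 (apply: definable_ex; cbv beta); apply: definable_and; first by definable.
  apply: definable_and; first by definable.
  apply: definable_and; first by undefinable; definable.
  exact: (definable_subst (fun k => if k is 0%N then 1%N else 0%N) hR).
exists F => p; rewrite hF; split.
  by move=> [_ [x [y [xW [yZ [hp hr]]]]]]; exists x, y.
move=> [x [y [xW yZ hr hp]]]; split; first exact: hc xW yZ hp.
by exists x, y.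
Qed.

Lemma nat_induction (P : M -> Prop) n : definable (fun v => P (v 0%N)) ->
  (forall e, is_empty e -> P e) ->
  (forall x y, P x -> is_succ y x -> P y) -> is_nat n -> P n.
Proof.
move=> dP P0 PS hn; have [I [[e [he eI]] hI]] := z_infinity zM.
have [J hJ] := separation I dP.
have /hn/hJ[]// : inductive J.
split; first by exists e; split=> //; apply/hJ; split=> //; exact: P0.
move=> x /hJ[/hI [y [hy yI]] Px]; exists y; split=> //; apply/hJ; split=> //.
exact: PS hy.
Qed.

Lemma nat_trans_irr n : is_nat n ->
  (forall x y, mem x n -> mem y x -> mem y n) /\ ~ mem n n.
Proof.
apply: (@nat_induction (fun n => (forall x y, mem x n -> mem y x -> mem y n) /\
  ~ mem n n)); first by definable.
  by move=> e he; split=> [x y /he|/he].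
move=> x y [tx ix] hy; split=> [u v /hy[ux|->] vu|].
- by apply/hy; left; exact: tx vu.
- by apply/hy; left.
- have xy : mem x y by apply/hy; right.
  by move=> /hy[yx|e]; [apply: ix; exact: tx xy|apply: ix; rewrite -{2}e].
Qed.

Lemma nat_succ x y : is_succ y x -> is_nat x -> is_nat y.
Proof.
move=> hy hx I hI; have [z [hz zI]] := hI.2 _ (hx _ hI).
by have -> : y = z by apply: (z_ext zM) => u; rewrite hy hz.
Qed.

(* Kuratowski finiteness, used only in the proofs below. *)
Definition kfinite A := forall F, (forall e, is_empty e -> mem e F) ->
  (forall a b x, mem a F -> mem x A ->
     (forall y, mem y b <-> mem y a \/ y = x) -> mem b F) -> mem A F.

Lemma kfinite_ind A (P : M -> Prop) : definable (fun v => P (v 0%N)) ->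
  (forall e, is_empty e -> P e) ->
  (forall a b x, (forall y, mem y a -> mem y A) -> mem x A -> P a ->
     (forall y, mem y b <-> mem y a \/ y = x) -> P b) ->
  kfinite A -> P A.
Proof.
move=> dP P0 PS hA; have [w hw] := z_power zM A; have [F hF] := separation w dP.
have /hF[]// : mem A F; apply: hA.
  by move=> e he; apply/hF; split; [apply/hw => z /he|exact: P0].
move=> a b x /hF[/hw aA Pa] xA hb; apply/hF; split.
  by apply/hw => z /hb[/aA|->].
exact: PS hb.
Qed.

Lemma kfinite_union A B C : kfinite A -> kfinite B ->
  (forall x, mem x C <-> mem x A \/ mem x B) -> kfinite C.
Proof.
move=> fA fB hC F F0 FS.
have FA : mem A F.
  apply: fA => // a b x aF xA; apply: FS => //; apply/hC; by left.
have := @kfinite_ind B (fun b => forall c,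
  (forall x, mem x c <-> mem x A \/ mem x b) -> mem c F).
apply=> //; first by definable.
- move=> e he c hc; suff -> : c = A by [].
  by apply: (z_ext zM) => x; rewrite hc; split=> [[//|/he]//|]; left.
- move=> a b x aB xB IH hb c hc.
  have [w hw] := z_pair zM A a; have [c' hc'] := z_union zM w.
  have hc'' y : mem y c' <-> mem y A \/ mem y a.
    rewrite hc'; split=> [[z [/hw[->|->]]]|[h|h]]; [by left|by right|..].
      by exists A; split=> //; exact: upair_l hw.
    by exists a; split=> //; exact: upair_r hw.
  apply: (FS c' c x (IH _ hc'')); first by apply/hC; right.
  by move=> y; rewrite hc hb hc''; tauto.
Qed.

Definition enumeration n e B :=
  (forall i, mem i n -> exists c, related e i c) /\
  (forall i c, related e i c -> mem i n /\ mem c B) /\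
  (forall i c d, related e i c -> related e i d -> c = d) /\
  (forall c, mem c B -> exists i, related e i c).

Lemma kfinite_enumeration A : kfinite A ->
  exists n e, is_nat n /\ enumeration n e A.
Proof.
apply: (@kfinite_ind A (fun A => exists n e, is_nat n /\ enumeration n e A)).
- by rewrite /enumeration; undefinable; definable.
- move=> z hz; exists z, z; split=> [I [[e [he eI]] _]|].
    by suff -> : z = e by []; apply: (z_ext zM) => x; split=> [/hz|/he].
  split=> [i /hz//|]; split=> [i c [p [_ /hz//]]|].
  by split=> [i c d [p [_ /hz]]|c /hz].
- move=> a b x _ _ [n [e [hn [e1 [e2 [e3 e4]]]]]] hb.
  have [n' hn'] := ex_adjoin n n; have [p hp] := ex_opair n x.
  have [e' he'] := ex_adjoin e p.
  have relE i c : related e' i c <-> related e i c \/ i = n /\ c = x.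
    split=> [[q [hq /he'[qe|qp]]]|[[q [hq qe]]|[-> ->]]].
    - by left; exists q.
    - by subst q; right; have [-> ->] := opair_inj hq hp.
    - by exists q; split=> //; apply/he'; left.
    - by exists p; split=> //; apply/he'; right.
  exists n', e'; split; first exact: nat_succ hn' hn.
  have [_ nn] := nat_trans_irr hn.
  split=> [i /hn'[/e1[c hc]|->]|].
  + by exists c; apply/relE; left.
  + by exists x; apply/relE; right.
  split=> [i c /relE[/e2[hi hc]|[-> ->]]|].
  + by split; [apply/hn'|apply/hb]; left.
  + by split; [apply/hn'|apply/hb]; right.
  split=> [i c d /relE hc /relE hd|c /hb[/e4[i hi]|->]].
  + case: hc hd => [hc|[-> ->]] [hd|[e0 ->]] //; first exact: e3 hc hd.
      by exfalso; apply: nn; rewrite -{1}e0; have [] := e2 _ _ hc.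
    by exfalso; apply: nn; have [] := e2 _ _ hd.
  + by exists i; apply/relE; left.
  + by exists n; apply/relE; right.
Qed.

End Zermelo.

Section Chains.
Context (M : memStruct) (zM : zermelo M) (X : M) (G : intAbGroup M).
Implicit Types (c y F A : M) (p : nat).

Let z0 := elval (0 : gelt G).

Lemma tuple_codes n : exists W : M, forall c,
  mem c W <-> exists t : n.-tuple (El X), tuple_code t c.
Proof.
elim: n => [|n [W hW]].
  have [e he] := ex_empty zM; have [W hW] := ex_adjoin zM e e.
  exists W => c; rewrite hW; split.
    move=> h; exists [tuple] => /=.
    by case: h => [/he//|->].
  move=> [t]; rewrite tuple0 /tuple_code /= => hc; right.
  by apply: (z_ext zM) => x; split=> [/hc|/he].
have [F hF] := @ex_graph _ zM X W (fun _ _ => True) (definable_cst _ X).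
exists F => c; rewrite hF; split.
  move=> [x [d [xX /hW[t ht] _ hc]]]; exists [tuple of MkEl xX :: t].
  by exists d.
move=> [t]; case/tupleP: t => x t [d [hd hc]]; exists (elval x), d.
by split=> //; [exact: elvalP|apply/hW; exists t].
Qed.

Lemma tuple_code_ex n (t : n.-tuple (El X)) : exists c, tuple_code t c.
Proof.
rewrite /tuple_code; case: t => s /= _; elim: s => [|x s [d hd]] /=.
  exact: ex_empty zM.
by have [c hc] := ex_opair zM (elval x) d; exists c, d.
Qed.

Lemma tuple_code_fun n (t : n.-tuple (El X)) c d :
  tuple_code t c -> tuple_code t d -> c = d.
Proof.
rewrite /tuple_code; case: t => s /= _; elim: s c d => [|x s IHs] /= c d.
  by move=> hc hd; apply: (z_ext zM) => x; split=> [/hc|/hd].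
move=> [c' [h hc]] [d' [h' hd]]; rewrite (IHs _ _ h h') in hc.
exact: (opair_ext zM hc hd).
Qed.

Lemma tuple_code_inj n (t u : n.-tuple (El X)) c :
  tuple_code t c -> tuple_code u c -> t = u.
Proof.
elim: n t u c => [|n IHn] t u c; first by rewrite (tuple0 t) (tuple0 u).
case/tupleP: t => x t; case/tupleP: u => y u [d [hd hc]] [d' [hd' hc']].
have [/elval_inj-> e] := opair_inj hc hc'; subst d'.
by rewrite (IHn _ _ _ hd hd').
Qed.

Section Degree.
Context (p : nat).
Local Notation simplex := (simplex X p).
Local Notation scode := (@simplex_code M X p).
Implicit Types (f : simplex -> gelt G) (s t : simplex).

Lemma chain_codeE f F : chain_code f F -> forall s c, scode s c ->
  forall y, related F c y <-> y = elval (f s).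
Proof.
move=> [h1 h2] s c sc y; split.
  move=> [q [hq /h2 [s' [x' [y' [sx' hy' hq']]]]]].
  have [e1 e2] := opair_inj hq hq'; subst x' y'.
  by rewrite (tuple_code_inj sc sx').
move=> ->; have [x [y' [sx hy' r]]] := h1 s.
by rewrite -[elval _]hy' (tuple_code_fun sc sx).
Qed.

Lemma ex_chain_code f (R : M -> M -> Prop) :
  definable (fun v => R (v 0%N) (v 1%N)) ->
  (forall s c, scode s c -> R c (elval (f s))) ->
  (forall s c y, scode s c -> R c y -> y = elval (f s)) ->
  exists F, chain_code f F.
Proof.
move=> dR R1 R2; have [W hW] := tuple_codes p.+1.
have [F hF] := ex_graph zM W (gset G) dR; exists F; split.
  move=> s; have [c sc] := tuple_code_ex s; exists c, (elval (f s)).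
  split=> //; have [q hq] := ex_opair zM c (elval (f s)); exists q; split=> //.
  apply/hF; exists c, (elval (f s)); split=> //; last exact: R1.
    by apply/hW; exists s.
  exact: elvalP.
move=> q /hF[c [y [/hW[s sc] yG r hq]]]; exists s, c, y; split=> //.
exact: R2 sc r.
Qed.

(* Chains are the internal functions whose support is contained in a
   hyperfinite set of simplices satisfying P. *)
Definition supported (P : simplex -> Prop) f :=
  (exists F, chain_code f F) /\ exists A, [/\ kfinite A,
    forall c, mem c A -> exists s, P s /\ scode s c &
    forall s c, scode s c -> f s <> 0 -> mem c A].

Lemma elval0 f s : elval (f s) = z0 <-> f s = 0.
Proof. by split=> [|->//]; exact: elval_inj. Qed.

Lemma chains_supported (P : simplex -> Prop) f : chains P f -> supported P f.
Proof.
move=> [n [hn [g [s [[Gg hGg] [S hS] sP [m [hm [t [[T hT] t0 tS tn]]]]]]]]].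
have nm : mem n m by apply/hm; right.
have relS c i : related S i c <-> exists k : El n, elval k = i /\ scode (s k) c.
  case: hS => h1 h2; split.
    move=> [q [hq /h2[k [x [y [kx ky hq']]]]]].
    by have [-> ->] := opair_inj hq hq'; exists k; rewrite kx.
  move=> [k [<- sc]]; have [x [y [kx ky r]]] := h1 k.
  by rewrite -kx (tuple_code_fun sc ky).
have relT F i : related T i F <-> exists k : El m, elval k = i /\
    chain_code (t k) F /\ related T i F.
  case: hT => h1 h2; split; last by case=> k [_ []].
  move=> [q [hq /[dup] qT /h2[k [x [y [kx ky hq']]]]]].
  have [e1 e2] := opair_inj hq hq'; subst; exists k; rewrite kx; split=> //.
  by split=> //; exists q; rewrite -kx.
split.
  by have [x [F [_ hF _]]] := hT.1 (MkEl nm); exists F; rewrite tn in hF.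
have [W hW] := tuple_codes p.+1.
have dfB k : exists B, forall c, mem c B <->
    mem c W /\ exists i, mem i k /\ related S i c.
  by apply: (separation zM); undefinable; definable.
have [A hA] := dfB n.
have inA k (i : El n) c : scode (s i) c -> mem c W /\
   (mem (elval i) k -> exists i, mem i k /\ related S i c).
  move=> sc; split; first by apply/hW; exists (s i).
  by move=> ik; exists (elval i); split=> //; apply/relS; exists i.
exists A; split.
- move=> F F0 FS.
  suff : (forall i, mem i n -> mem i n) -> forall B, (forall c, mem c B <->
    mem c W /\ exists i, mem i n /\ related S i c) -> mem B F by exact.
  have := @nat_induction _ zM (fun k => (forall i, mem i k -> mem i n) ->
    forall B, (forall c, mem c B <-> mem c W /\ exists i, mem i k /\
      related S i c) -> mem B F) n.
  apply=> //; first by undefinable; definable.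
    move=> e he _ B hB; apply: F0 => c /hB[_ [i [/he]]] //.
  move=> x y IH hy yn B hB; have [B' hB'] := dfB x.
  have xn : mem x n by apply: yn; apply/hy; right.
  have [c sc] := tuple_code_ex (s (MkEl xn)).
  apply: (FS B' B c); first by apply: IH => // i ix; apply: yn; apply/hy; left.
    by apply/hA; have [cW h] := inA n _ _ sc; split=> //; apply: h.
  move=> d; rewrite hB hB'; split.
    move=> [dW [i [/hy[ix|->] r]]]; first by left; split=> //; exists i.
    right; move/relS: r => [k [ek sd]].
    suff e : k = MkEl xn by rewrite e in sd; exact: tuple_code_fun sd sc.
    exact: elval_inj.
  move=> [[dW [i [ix r]]]|->].
    by split=> //; exists i; split=> //; apply/hy; left.
  have [cW h] := inA y _ _ sc; split=> //; apply: h => /=; apply/hy; by right.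
- move=> c /hA[_ [i [_ /relS[k [_ sc]]]]]; by exists (s k).
- move=> u c uc fu; apply: contrapT => cA; apply: fu.
  rewrite -(tn (MkEl nm)) //.
  suff h : mem n m -> forall F y, related T n F -> related F c y -> y = z0.
    have [x [F [nx hF r]]] := hT.1 (MkEl nm).
    apply/elval0; apply: (h nm F); first by rewrite nx in r.
    by apply/(chain_codeE hF uc).
  apply: (@nat_induction _ zM (fun k => mem k m -> forall F y,
    related T k F -> related F c y -> y = z0) n) => //.
    by undefinable; definable.
    move=> e he em F y /relT[k [ek [hF _]]] /(chain_codeE hF uc)->.
    by rewrite t0 ?ek.
  move=> x x' IH hx' x'm F y /relT[k' [ek' [hF _]]] /(chain_codeE hF uc)->.
  have xn : mem x n.
    have xx' : mem x x' by apply/hx'; right.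
    move: x'm => /hm[x'n|e]; last by rewrite -e.
    exact: (nat_trans_irr zM hn).1 x'n xx'.
  have xm : mem x m by apply/hm; left.
  have xT : t (MkEl xm) u = 0.
    have [i [F' [ei hF' r]]] := hT.1 (MkEl xm).
    apply/elval0; apply: (IH xm F'); first by rewrite ei in r.
    by apply/(chain_codeE hF' uc).
  rewrite (tS (MkEl xn) (MkEl xm) k') ?ek' //; apply/elval0.
  have -> : (t (MkEl xm) + single (g (MkEl xn)) (s (MkEl xn))) u =
    t (MkEl xm) u + single (g (MkEl xn)) (s (MkEl xn)) u by [].
  rewrite xT add0r /single; case: eqP => // e; exfalso; apply: cA.
  apply/hA; rewrite e in uc; have [cW h] := inA n _ _ uc; split=> //.
  exact: h.
Qed.

Lemma supported_chains (P : simplex -> Prop) f : supported P f -> chains P f.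
Proof.
move=> [[F hF] [A [fA AP fsupp]]].
have relF s c y : scode s c -> related F c y <-> y = elval (f s).
  by move=> sc; exact: chain_codeE.
have [n [e [hn [e1 [e2 [e3 e4]]]]]] := kfinite_enumeration zM fA.
exists n; split=> //.
have sx (i : El n) : exists s, P s /\ exists c, related e (elval i) c /\ scode s c.
  have [c r] := e1 _ (elvalP i); have [s [Ps sc]] := AP _ (e2 _ _ r).2.
  by exists s; split=> //; exists c.
pose s i := projT1 (cid (sx i)).
have sP i : P (s i) by have [] := projT2 (cid (sx i)).
have sE i c : related e (elval i) c <-> scode (s i) c.
  have [_ [d [r sd]]] := projT2 (cid (sx i)); split.
    by move=> r'; rewrite (e3 _ _ _ r' r).
  by move=> sc; rewrite (tuple_code_fun sc sd).
have eE k c : related e k c -> exists i : El n, elval i = k /\ scode (s i) c.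
  move=> r; have [kn _] := e2 _ _ r; exists (MkEl kn); split=> //.
  exact/sE.
(* the simplex t is listed before stage k *)
pose Q k (t : simplex) := exists i, mem i k /\ exists c, related e i c /\ scode t c.
have QE k t c : scode t c -> Q k t <-> exists i, mem i k /\ related e i c.
  move=> tc; split=> [[i [ik [d [r td]]]]|[i [ik r]]]; exists i; split=> //.
    by rewrite (tuple_code_fun tc td).
  by exists c.
pose g i := if `[< Q (elval i) (s i) >] then 0 else f (s i).
have [m hm] := ex_adjoin zM n n.
pose t (k : El m) (u : simplex) := if `[< Q (elval k) u >] then f u else 0.
have [W hW] := tuple_codes p.+1.
have [B hB] := ex_product zM W (gset G); have [Z hZ] := z_power zM B.
have tcode k : exists2 F', mem F' Z & forall q, mem q F' <->
    exists c y, [/\ mem c W, mem y (gset G),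
      (exists i, mem i k /\ related e i c) /\ related F c y \/
      ~ (exists i, mem i k /\ related e i c) /\ y = z0 & is_opair q c y].
  have [|F' hF'] := @ex_graph _ zM W (gset G) (fun c y =>
      (exists i, mem i k /\ related e i c) /\ related F c y \/
      ~ (exists i, mem i k /\ related e i c) /\ y = z0).
    by undefinable; definable.
  exists F' => //; apply/hZ => q /hF'[c [y [cW yG _ hq]]]; exact: hB cW yG hq.
exists g, s; split=> //.
- have [|Gg hGg] := @ex_graph _ zM n (gset G) (fun i y =>
    (exists i', mem i' i /\ exists c, related e i' c /\ related e i c) /\ y = z0 \/
    ~ (exists i', mem i' i /\ exists c, related e i' c /\ related e i c) /\
    exists c, related e i c /\ related F c y).
    by undefinable; definable.
  have giE (i : El n) : Q (elval i) (s i) <-> exists i', mem i' (elval i) /\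
      exists c, related e i' c /\ related e (elval i) c.
    by split=> -[i' [h [c [h1 h2]]]]; exists i'; split=> //; exists c; split=> //;
      exact/sE.
  exists Gg; split.
    move=> i; exists (elval i), (elval (g i)); split=> //.
    have [q hq] := ex_opair zM (elval i) (elval (g i)); exists q; split=> //.
    apply/hGg; exists (elval i), (elval (g i)); split=> //; try exact: elvalP.
    rewrite /g; case: asboolP => [/giE h|h]; [by left|right; split].
      by move/giE.
    have [c sc] := tuple_code_ex (s i); exists c; split; first exact/sE.
    exact/(relF _ _ _ sc).
  move=> q /hGg[k [y [kn yG h hq]]]; exists (MkEl kn), k, y; split=> //.
  rewrite /gelt_code /el_code /g.
  case: asboolP => /giE/= hQ; case: h => -[h h'] //.
  by have [c [/(sE (MkEl kn)) sc /(relF _ _ _ sc)]] := h'.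
- have [|S hS] := @ex_graph _ zM n W (related e).
    by undefinable; definable.
  exists S; split.
    move=> i; have [c sc] := tuple_code_ex (s i); exists (elval i), c; split=> //.
    have [q hq] := ex_opair zM (elval i) c; exists q; split=> //; apply/hS.
    exists (elval i), c; split=> //; [exact: elvalP| |exact/sE].
    by apply/hW; exists (s i).
  move=> q /hS[k [c [kn cW r hq]]]; exists (MkEl kn), k, c; split=> //.
  exact/(sE (MkEl kn)).
- exists m; split=> //; exists t; split.
  + have tF (k : El m) F' : (forall q, mem q F' <->
        exists c y, [/\ mem c W, mem y (gset G),
        (exists i, mem i (elval k) /\ related e i c) /\ related F c y \/
        ~ (exists i, mem i (elval k) /\ related e i c) /\ y = z0 & is_opair q c y]) ->
        chain_code (t k) F'.
      move=> hF'; split.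
        move=> u; have [c uc] := tuple_code_ex u; exists c, (elval (t k u)).
        split=> //; have [q hq] := ex_opair zM c (elval (t k u)).
        exists q; split=> //; apply/hF'; exists c, (elval (t k u)); split=> //.
        * by apply/hW; exists u.
        * exact: elvalP.
        rewrite /t; case: asboolP => /(QE _ _ _ uc) h; [left|right]; split=> //.
        exact/(relF _ _ _ uc).
      move=> q /hF'[c [y [/hW[u uc] yG h hq]]]; exists u, c, y; split=> //.
      rewrite /gelt_code /el_code /t.
      case: asboolP => /(QE _ _ _ uc) hQ; case: h => -[h h'] //.
      exact/(relF _ _ _ uc).
    have [|T hT] := @ex_graph _ zM m Z (fun k F' => forall q, mem q F' <->
        exists c y, mem c W /\ mem y (gset G) /\
        ((exists i, mem i k /\ related e i c) /\ related F c y \/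
        ~ (exists i, mem i k /\ related e i c) /\ y = z0) /\ is_opair q c y).
      by undefinable; definable.
    have and4E F' k : (forall q, mem q F' <->
        exists c y, mem c W /\ mem y (gset G) /\
        ((exists i, mem i k /\ related e i c) /\ related F c y \/
        ~ (exists i, mem i k /\ related e i c) /\ y = z0) /\ is_opair q c y) <->
      (forall q, mem q F' <->
        exists c y, [/\ mem c W, mem y (gset G),
        (exists i, mem i k /\ related e i c) /\ related F c y \/
        ~ (exists i, mem i k /\ related e i c) /\ y = z0 & is_opair q c y]).
      by split=> h q; rewrite h; split=> -[c [y]];
        [move=> [? [? []]]|case|case|move=> [? [? []]]]; exists c, y.
    exists T; split.
      move=> k; have [F' F'Z /[dup] hF' /tF tk] := tcode (elval k).
      exists (elval k), F'; split=> //.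
      have [q hq] := ex_opair zM (elval k) F'; exists q; split=> //.
      by apply/hT; exists (elval k), F'; split=> //; [exact: elvalP|exact/and4E].
    move=> q /hT[k [F' [km F'Z /and4E hF' hq]]]; exists (MkEl km), k, F'.
    by split=> //; apply: tF.
  + move=> k ek; apply/funext => u; rewrite /t; case: asboolP => //.
    by move=> [i [/ek]].
  + move=> i k k' ek hk'; apply/funext => u.
    have -> : (t k + single (g i) (s i)) u = t k u + single (g i) (s i) u by [].
    have hQ : Q (elval k') u <-> Q (elval k) u \/ u = s i.
      have [c uc] := tuple_code_ex u; rewrite !(QE _ _ _ uc); split.
        move=> [i' [/hk'[h|->] r]]; first by left; exists i'; rewrite ek.
        by right; move/sE: r => sc; exact: tuple_code_inj uc sc.
      move=> [[i' [h r]]|ui].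
        by exists i'; split=> //; apply/hk'; left; rewrite -ek.
      exists (elval i); split; first by apply/hk'; right.
      by apply/sE; rewrite -ui.
    rewrite /t /single /g -ek; case: (asboolP (Q (elval k) u)) => Qk.
      case: asboolP => [_|]; last by move=> []; apply/hQ; left.
      by case: eqP => [<-|_]; rewrite ?addr0 //; case: asboolP; rewrite ?addr0.
    rewrite add0r; case: eqP => [e0|ne].
      rewrite -e0; case: asboolP => [_|[]]; last by apply/hQ; right.
      by case: asboolP.
    by case: asboolP => // /hQ[].
  + move=> k kn; apply/funext => u; rewrite /t; case: asboolP => // nQ.
    apply/esym; apply: contrapT => fu; apply: nQ.
    have [c uc] := tuple_code_ex u; apply/(QE _ _ _ uc).
    have [i r] := e4 _ (fsupp _ _ uc fu); exists i; split=> //.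
    by rewrite kn; exact: (e2 _ _ r).1.
Qed.

Lemma supported_zmod_closed (P : simplex -> Prop) :
  supported P 0 /\ forall f f', supported P f -> supported P f' ->
  supported P (f - f').
Proof.
split.
  split; first by apply: (@ex_chain_code 0 (fun _ y => y = z0)); first by definable.
  have [A hA] := ex_empty zM; exists A; split=> [F F0 _|c /hA//|//].
  exact: F0.
move=> f f' [[F hF] [A [fA AP supA]]] [[F' hF'] [A' [fA' AP' supA']]]; split.
  apply: (@ex_chain_code _ (fun c y => exists u v, related F c u /\
    related F' c v /\ apply2 (gop G) y v u /\ mem y (gset G))).
  - by undefinable; definable.
  - move=> s c sc; exists (elval (f s)), (elval (f' s)).
    split; first exact/(chain_codeE hF sc).
    split; first exact/(chain_codeE hF' sc).
    split; last exact: elvalP.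
    have -> : f s = gplus ((f - f') s) (f' s) by apply/esym; exact: subrK.
    exact: gplusP.
  - move=> s c y sc [u [v [/(chain_codeE hF sc)-> [/(chain_codeE hF' sc)->]]]].
    move=> [h yG]; have e : (MkEl yG : gelt G) + f' s = f s by exact: gplusE.
    have -> : (f - f') s = f s - f' s by [].
    by rewrite -e addrK.
have [w hw] := z_pair zM A A'; have [B hB] := z_union zM w.
have hB' x : mem x B <-> mem x A \/ mem x A'.
  rewrite hB; split=> [[z [/hw[->|->]]]|[h|h]]; [by left|by right|..].
    by exists A; split=> //; apply/hw; left.
  by exists A'; split=> //; apply/hw; right.
exists B; split; first exact: (kfinite_union zM fA fA' hB').
  by move=> c /hB'[/AP|/AP'].
move=> s c sc h; apply/hB'; have [f0|] := pselect (f s = 0); last first.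
  by move=> f0; left; exact: supA sc f0.
right; apply: supA' sc _ => f0'; apply: h.
by have -> : (f - f') s = f s - f' s by []; rewrite f0 f0' subr0.
Qed.

Lemma chains_zmod_closed (P : simplex -> Prop) :
  zmod_closed [pred f : simplex -> gelt G | `[< chains P f >]].
Proof.
have [h0 hB] := supported_zmod_closed P.
split; first exact/asboolP/supported_chains.
move=> f f' /asboolP/chains_supported h /asboolP/chains_supported h'.
exact/asboolP/supported_chains/hB.
Qed.

End Degree.
End Chains.

Section MuHomology.
Context (N : nsUniverse) (X : uniformSpace (std N)) (G : intAbGroup (nst N)).

Definition starX : nst N := star (points X).

Definition infinitely_close (x y : El starX) :=
  forall E, mem E (entourages X) -> related (star E) (elval x) (elval y).

Definition microsimplex (p : nat) (s : simplex starX p) :=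
  forall i j, infinitely_close (tnth s i) (tnth s j).

Lemma nst_zermelo : zermelo (nst N).
Proof. exact: zermelo_transfer (@star_elementary N) (@std_zermelo N). Qed.

Definition chain_pred (p : nat) : {pred simplex starX p -> gelt G} :=
  [pred f | `[< chains (fun=> True) f >]].
HB.instance Definition _ (p : nat) :=
  GRing.isZmodClosed.Build (simplex starX p -> gelt G) (@chain_pred p)
    (@chains_zmod_closed _ nst_zermelo _ G p (fun=> True)).

Record chain (p : nat) := Chain {
  chain_val : simplex starX p -> gelt G;
  _ : chain_val \in @chain_pred p }.
HB.instance Definition _ (p : nat) := [isSub for @chain_val p].
HB.instance Definition _ (p : nat) := [Choice of chain p by <:].
HB.instance Definition _ (p : nat) := [SubChoice_isSubZmodule of chain p by <:].

(* c belongs to the subgroup M_p(X; G) of C_p(X; G). *)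
Definition microchain (p : nat) (c : chain p) :=
  chains (@microsimplex p) (val c).

(* D is the internal homomorphism with D (g s) = \sum_i (-1)^i g (d_i s) for
   all g and s, where d_i s omits the i-th vertex of s. *)
Definition is_boundary (p : nat) (D : {additive chain p.+1 -> chain p}) :=
  internal (fun c => chain_code (val c)) (fun c => chain_code (val c)) D /\
  forall (g : gelt G) (s : simplex starX p.+1) (c : chain p.+1),
    val c = single g s ->
    val (D c) = \sum_(i < p.+2) single g (face i s) *~ (-1) ^+ i.

(* Such a D exists and is unique, since C_(p+1) is the internal free sum of
   copies of G indexed by the simplices; the value \0 is never taken. *)
Definition boundary (p : nat) : {additive chain p.+1 -> chain p} :=
  if pselect (exists D : {additive chain p.+1 -> chain p}, is_boundary D)
    is left h then projT1 (cid h) else \0.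

Definition is_cycle (p : nat) : chain p -> Prop :=
  match p with
  | 0 => fun c => microchain c
  | q.+1 => fun c => microchain c /\ boundary q c = 0
  end.

Lemma microchain_zmod_closed p :
  zmod_closed [pred c : chain p | `[< microchain c >]].
Proof.
have [h0 hB] := @chains_zmod_closed _ nst_zermelo _ G p (@microsimplex p).
split=> [|c d /asboolP hc /asboolP hd]; apply/asboolP.
  by have /asboolP := h0; rewrite /microchain raddf0.
rewrite /microchain raddfB; apply/asboolP; apply: hB; exact/asboolP.
Qed.

Definition cycle_pred (p : nat) : {pred chain p} := [pred c | `[< is_cycle c >]].
Lemma cycle_zmod_closed p : zmod_closed (@cycle_pred p).
Proof.
have [/asboolP h0 hB] := microchain_zmod_closed p.
case: p h0 hB => [|p] h0 hB; split=> [|c d /asboolP hc /asboolP hd]; apply/asboolP.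
- exact: h0.
- by have /asboolP := hB c d (asboolT hc) (asboolT hd).
- by split=> //; exact: raddf0.
- case: hc hd => hc ec [hd ed]; split; last by rewrite raddfB ec ed subr0.
  by have /asboolP := hB c d (asboolT hc) (asboolT hd).
Qed.
HB.instance Definition _ (p : nat) :=
  GRing.isZmodClosed.Build (chain p) (@cycle_pred p) (@cycle_zmod_closed p).

Record cycle (p : nat) := Cycle {
  cycle_val : chain p;
  _ : cycle_val \in @cycle_pred p }.
HB.instance Definition _ (p : nat) := [isSub for @cycle_val p].
HB.instance Definition _ (p : nat) := [Choice of cycle p by <:].
HB.instance Definition _ (p : nat) := [SubChoice_isSubZmodule of cycle p by <:].

(* The boundary map lives on chains; its restriction to microchains is taken in
   [is_cycle] and here. Boundaries of microchains are cycles, so the values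
   [val z] with z in [bounds] are all the boundaries of microchains. *)
Definition bounds (p : nat) : {pred cycle p} :=
  [pred z | `[< exists2 c : chain p.+1, microchain c & boundary p c = val z >]].
Lemma bounds_zmod_closed p : zmod_closed (@bounds p).
Proof.
have [/asboolP h0 hB] := microchain_zmod_closed p.+1.
split=> [|z w /asboolP[c hc ec] /asboolP[d hd ed]]; apply/asboolP.
  by exists 0; rewrite ?raddf0.
exists (c - d); last by rewrite !raddfB ec ed.
by have /asboolP := hB c d (asboolT hc) (asboolT hd).
Qed.
HB.instance Definition _ (p : nat) :=
  GRing.isZmodClosed.Build (cycle p) (@bounds p) (@bounds_zmod_closed p).

(* M_p(X; G) = 0 for p < 0, hence H_p(X; G) is the zero group there. *)
Definition homology (p : int) : zmodType :=
  match p with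
  | Posz n => Quotient.quot (@bounds n)
  | Negz _ => 'rV[int]_0
  end.

End MuHomology.

(* Main.v *)
(* A one-point space has a single p-simplex in every degree, which is a
   microsimplex, so M_p = C_p = G through the coefficient of that simplex. All
   faces of the (p+1)-simplex coincide, so the boundary M_(p+1) -> M_p is
   multiplication by the alternating sum of p + 2 signs: the identity for odd p
   and zero for even p. *)
From HB Require Import structures.
From mathcomp Require Import all_boot all_order all_algebra.
From mathcomp Require Import boolp classical_sets functions.
Require Import Defs.

Set Implicit Arguments.
Unset Strict Implicit.
Unset Printing Implicit Defensive.

Import GRing.Theory.
Local Open Scope ring_scope.
Local Open Scope quotient_scope.

(** * Transfer along elementary embeddings, and alternating sums *)

Lemma elementary_one_point (U V : memStruct) (j : U -> V) (A a : U) :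
  elementary j -> (forall x, mem x A <-> x = a) ->
  forall x, mem x (j A) <-> x = j a.
Proof.
move=> hj hA.
exact: (hj (All (Iff (Mem 0 1) (Eqv 0 2))) (scons A (scons a (fun=> a)))).1 hA.
Qed.

Lemma elementary_related (U V : memStruct) (j : U -> V) (r x y : U) :
  elementary j -> related r x y -> related (j r) (j x) (j y).
Proof.
move=> hj.
(* De Bruijn forms of [is_upair] and [is_opair]: indices go up by one under each quantifier. *)
pose upair c a b := All (Iff (Mem 0 c.+1) (Or (Eqv 0 a.+1) (Eqv 0 b.+1))).
pose opair p a b := Ex (Ex (And (upair 1 a.+2 a.+2)
  (And (upair 0 a.+2 b.+2) (upair p.+2 1 0))))%N.
exact: (hj (Ex (And (opair 0 2 3) (Mem 0 1)))%N
  (scons r (scons x (scons y (fun=> x))))).1.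
Qed.

Lemma sum_signs (V : zmodType) (x : V) n :
  \sum_(i < n) x *~ (-1) ^+ i = x *+ odd n.
Proof.
elim: n => [|n IHn]; first by rewrite big_ord0.
rewrite big_ord_recr /= IHn -signr_odd.
by case: (odd n) => /=; rewrite ?mulrN1z ?subrr ?add0r.
Qed.

(** * Chains in a degree with a single simplex *)

Section OneSimplex.
Context (M : memStruct) (zM : zermelo M) (X : M) (G : intAbGroup M).

Lemma one_simplex_chains p (s0 : simplex X p) (P : simplex X p -> Prop)
  (f : simplex X p -> gelt G) : all_equal_to s0 -> P s0 -> chains P f.
Proof.
move=> hs Ps0; apply: (supported_chains zM); split.
  apply: (@ex_chain_code _ zM _ _ _ _ (fun _ y => y = elval (f s0))).
  - by have := X => c; definable.
  - by move=> s c _; rewrite (hs s).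
  - by move=> s c y _ ->; rewrite (hs s).
(* The singleton {c0} of the code of [s0] is a finite set containing the support. *)
have [c0 hc0] := tuple_code_ex zM s0.
have [e he] := ex_empty zM; have [A hA] := ex_adjoin zM e c0.
exists A; split.
- move=> F F0 FS; apply: (FS e A c0) => //; first exact: F0.
  by apply/hA; right.
- by move=> c /hA[/he//|->]; exists s0.
- move=> s c sc _; apply/hA; right; rewrite (hs s) in sc.
  exact: tuple_code_fun sc hc0.
Qed.

Lemma one_simplex_chain_code p (s0 : simplex X p) c0 (f : simplex X p -> gelt G) F :
  all_equal_to s0 -> simplex_code s0 c0 ->
  (forall q, mem q F <-> is_opair q c0 (elval (f s0))) -> chain_code f F.
Proof.
move=> hs sc hF; split.
  move=> s; exists c0, (elval (f s)); rewrite (hs s); split=> //.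
  by have [q hq] := ex_opair zM c0 (elval (f s0)); exists q; split=> //; apply/hF.
by move=> q /hF hq; exists s0, c0, (elval (f s0)).
Qed.

(** Separation cuts the graph out of a product. [W] and [Z] need only contain one code of each
    argument and of its value. *)
Lemma internal_graph (S T : Type) (cS : S -> M -> Prop) (cT : T -> M -> Prop)
    (f : S -> T) (W Z : M) (R : M -> M -> Prop) :
  definable (fun v => R (v 0%N) (v 1%N)) ->
  (forall s, exists x y,
     [/\ cS s x, cT (f s) y, mem x W, mem y Z & R x y]) ->
  (forall x y, R x y -> exists2 s, cS s x & cT (f s) y) ->
  internal cS cT f.
Proof.
move=> dR h1 h2; have [F hF] := ex_graph zM W Z dR; exists F; split.
  move=> s; have [x [y [sx sy xW yZ r]]] := h1 s; exists x, y; split=> //.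
  have [q hq] := ex_opair zM x y; exists q; split=> //.
  by apply/hF; exists x, y.
move=> q /hF[x [y [_ _ /h2[s sx sy] hq]]].
by exists s, x, y.
Qed.

(** The sets {(c, y)} code the chains on a simplex with code [c]; a power set bounds them all, as
    [internal_graph] requires. *)
Lemma opair_singletons (c : M) : exists Z : M, forall y, mem y (gset G) ->
  exists2 F, mem F Z & forall q, mem q F <-> is_opair q c y.
Proof.
have [e he] := ex_empty zM; have [C hC] := ex_adjoin zM e c.
have [B hB] := ex_product zM C (gset G); have [Z hZ] := z_power zM B.
exists Z => y yG; have [q hq] := ex_opair zM c y.
have [F hF] := ex_adjoin zM e q.
have FE r : mem r F <-> is_opair r c y.
  rewrite hF; split=> [[/he//|->//]|hr].
  by right; exact: (opair_ext zM hr hq).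
exists F => //; apply/hZ => r /FE hr.
by apply: hB hr => //; apply/hC; right.
Qed.

(* A homomorphism between copies of the group of coefficients is internal as
   soon as the corresponding endomorphism of that group is. *)
Lemma one_simplex_internal p p' (s0 : simplex X p) (s0' : simplex X p')
    (S S' : Type) (u : S -> simplex X p -> gelt G)
    (u' : S' -> simplex X p' -> gelt G) (D : S -> S') (h : gelt G -> gelt G) :
  all_equal_to s0 -> all_equal_to s0' ->
  (forall g, exists s, u s s0 = g) ->
  (forall s, u' (D s) s0' = h (u s s0)) ->
  internal (@el_code M (gset G)) (@el_code M (gset G)) h ->
  internal (fun s => chain_code (u s)) (fun s => chain_code (u' s)) D.
Proof.
move=> hs hs' surj hD [H [H1 H2]].
have [c sc] : exists c, simplex_code s0 c by exact: tuple_code_ex.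
have [c' sc'] : exists c, simplex_code s0' c by exact: tuple_code_ex.
have [W hW] := opair_singletons c; have [Z hZ] := opair_singletons c'.
(* The graph of [D] pairs {(c, y)} with {(c', y')} for (y, y') in the graph [H] of [h]. *)
apply: (@internal_graph _ _ _ _ D W Z (fun F F' => exists y y', related H y y' /\
  (forall q, mem q F <-> is_opair q c y) /\
  (forall q, mem q F' <-> is_opair q c' y'))).
- by undefinable; definable.
- move=> s; have [F FW hF] := hW _ (elvalP (u s s0)).
  have [F' FZ hF'] := hZ _ (elvalP (u' (D s) s0')).
  exists F, F'; split=> //.
  + exact: one_simplex_chain_code hs sc hF.
  + exact: one_simplex_chain_code hs' sc' hF'.
  exists (elval (u s s0)), (elval (u' (D s) s0')); split=> //.
  by rewrite hD; have [_ [_ [-> ->]]] := H1 (u s s0).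
move=> F F' [y [y' [[q [hq /H2[g [x [x' [ex ex' hx]]]]]] [hF hF']]]].
have [e e'] := opair_inj hq hx; rewrite /el_code in ex ex'; subst x x' y y'.
(* By surjectivity every coefficient comes from an argument of [D], so the relation holds only on
   the graph. *)
have [s es] := surj g; exists s.
  by apply: (one_simplex_chain_code hs sc); rewrite es.
by apply: (one_simplex_chain_code hs' sc'); rewrite hD es.
Qed.

(** The map is zero or the identity, with definable graph y = 0 or y = x. It serves for the factor
    [odd p] of the boundary. *)
Lemma internal_mulrn_bool (b : bool) :
  internal (@el_code M (gset G)) (@el_code M (gset G))
    (fun g : gelt G => g *+ b).
Proof.
case: b; last first.
  apply: (@internal_graph _ _ _ _ _ (gset G) (gset G)
    (fun x y => mem x (gset G) /\ y = elval (0 : gelt G))).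
  - by have := X => c; definable.
  - move=> g; exists (elval g), (elval (0 : gelt G)).
    by rewrite mulr0n; split=> //; [exact: elvalP|exact: elvalP|
      split=> //; exact: elvalP].
  - by move=> x y [xG ->]; exists (MkEl xG).
apply: (@internal_graph _ _ _ _ _ (gset G) (gset G)
  (fun x y => mem x (gset G) /\ y = x)).
- by have := X => c; definable.
- move=> g; exists (elval g), (elval g).
  by split=> //; [exact: elvalP|exact: elvalP|split=> //; exact: elvalP].
- by move=> x y [xG ->]; exists (MkEl xG).
Qed.

End OneSimplex.

(** * Chains of the one-point space *)

Section OnePoint.
Context (N : nsUniverse) (X : uniformSpace (std N)) (G : intAbGroup (nst N)).
Context (hX : one_point X).

(** Both the one-point property and the reflexivity of each standard entourage transfer. *)
Lemma one_point_star : exists x0 : El (starX X),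
  all_equal_to x0 /\ infinitely_close x0 x0.
Proof.
have [a ha] := hX; have hA := elementary_one_point (@star_elementary N) ha.
have aA : mem (star a) (starX X) by apply/hA.
exists (MkEl aA); split; first by move=> x; apply: elval_inj; apply/hA/elvalP.
move=> E EX; apply: (elementary_related (@star_elementary N)).
by apply: (ent_diag EX); apply/ha.
Qed.

Lemma one_point_simplex p : exists s0 : simplex (starX X) p,
  all_equal_to s0 /\ microsimplex s0.
Proof.
have [x0 [hx close]] := one_point_star; exists [tuple x0 | _ < p.+1]; split.
  by move=> s; apply: eq_from_tnth => i; rewrite (hx (tnth s i)) tnth_mktuple.
by move=> i j; rewrite !tnth_mktuple.
Qed.

Definition the_simplex p : simplex (starX X) p := projT1 (cid (one_point_simplex p)).

Lemma the_simplexE p : all_equal_to (the_simplex p).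
Proof. exact: (projT2 (cid (one_point_simplex p))).1. Qed.

Lemma microsimplex_the_simplex p : microsimplex (the_simplex p).
Proof. exact: (projT2 (cid (one_point_simplex p))).2. Qed.

Fact const_chain_subproof p (g : gelt G) :
  (fun=> g) \in @chain_pred N X G p.
Proof.
apply/asboolP; apply: one_simplex_chains (@the_simplexE p) I.
exact: nst_zermelo.
Qed.
Definition const_chain p (g : gelt G) : chain X G p :=
  Chain (const_chain_subproof p g).

(** The isomorphism from C_p to G, inverse to [const_chain]. *)
Definition coef p (c : chain X G p) : gelt G := val c (the_simplex p).

Fact coef_is_zmod_morphism p : zmod_morphism (@coef p).
Proof. by move=> c d; rewrite /coef raddfB. Qed.
HB.instance Definition _ p :=
  GRing.isZmodMorphism.Build (chain X G p) (gelt G) (@coef p)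
    (@coef_is_zmod_morphism p).

Lemma coefK p : cancel (@coef p) (@const_chain p).
Proof.
by move=> c; apply: val_inj; apply/funext => s /=; rewrite (the_simplexE s).
Qed.

Lemma const_chainK p : cancel (@const_chain p) (@coef p).
Proof. by []. Qed.

Lemma microchainT p (c : chain X G p) : microchain c.
Proof.
apply: one_simplex_chains (@the_simplexE p) (@microsimplex_the_simplex p).
exact: nst_zermelo.
Qed.

Lemma single_face_sum p (g : gelt G) (s : simplex (starX X) p.+1) (t : simplex (starX X) p) :
  (\sum_(i < p.+2) single g (face i s) *~ (-1) ^+ i) t = g *+ odd p.
Proof.
under eq_bigr => i _ do rewrite (the_simplexE (face i s)).
rewrite sum_signs /= negbK; case: (odd p); rewrite ?mulr1n ?mulr0n //.
by rewrite /single (the_simplexE t) eqxx.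
Qed.

(** * The boundary operator *)

(** An explicit witness of [is_boundary]; its existence keeps [boundary] from taking the default
    value [\0]. *)
Definition scale_boundary p (c : chain X G p.+1) : chain X G p :=
  const_chain p (coef c *+ odd p).

Fact scale_boundary_is_zmod_morphism p : zmod_morphism (@scale_boundary p).
Proof.
move=> c d; apply: (can_inj (@coefK p)).
by rewrite raddfB /= !const_chainK raddfB mulrnBl.
Qed.
HB.instance Definition _ p :=
  GRing.isZmodMorphism.Build (chain X G p.+1) (chain X G p) (@scale_boundary p)
    (@scale_boundary_is_zmod_morphism p).

Lemma is_boundary_scale p : is_boundary (@scale_boundary p : {additive _ -> _}).
Proof.
split.
  apply: (@one_simplex_internal _ (nst_zermelo N) _ _ _ _
    (the_simplex p.+1) (the_simplex p) _ _ _ _ _ (fun g => g *+ odd p)).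
  - exact: the_simplexE.
  - exact: the_simplexE.
  - by move=> g; exists (const_chain p.+1 g).
  - by [].
  - by apply: internal_mulrn_bool; [exact: nst_zermelo|exact: (starX X)].
move=> g s c hc; apply/funext => t.
by rewrite single_face_sum /= /coef hc /single (the_simplexE s) eqxx.
Qed.

Lemma boundaryE p (c : chain X G p.+1) : coef (boundary X G p c) = coef c *+ odd p.
Proof.
rewrite /boundary; case: pselect => [h|[]]; last first.
  by exists (@scale_boundary p); exact: is_boundary_scale.
case: cid => D [_ hD] /=.
(* Every chain here is a [single], so the face formula alone determines the chosen [D]. *)
rewrite {1}/coef (hD (coef c) (the_simplex p.+1)) ?single_face_sum //.
by apply/funext => s; rewrite /single /coef (the_simplexE s) eqxx.
Qed.

(** * Cycles, boundaries and homology *)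

(** For odd [p] the boundary out of degree p + 1 preserves the coefficient, hence is injective. *)
Lemma even_cycle_eq0 p (z : cycle X G p.+1) : odd p -> val z = 0.
Proof.
move=> op; apply: (can_inj (@coefK _)).
case: z => c /= /asboolP[_ bc].
rewrite raddf0 -[coef c]mulr1n -[1%N]/(nat_of_bool true) -op -boundaryE.
by rewrite bc raddf0.
Qed.

Lemma boundsE p (z : cycle X G p) :
  (z \in @bounds N X G p) = odd p || (val z == 0).
Proof.
apply/asboolP/orP => [[c _ bc]|].
  case: (boolP (odd p)) => op; [by left|right].
  apply/eqP/(can_inj (@coefK _)).
  by rewrite -bc boundaryE (negbTE op) mulr0n raddf0.
(* The chain with the same coefficient one degree up bounds in both cases: the factor is 1, or the
   coefficient is 0. *)
move=> h; exists (const_chain p.+1 (coef (val z))); first exact: microchainT.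
apply: (can_inj (@coefK _)); rewrite boundaryE const_chainK.
case: h => [->|/eqP->]; first exact: mulr1n.
by rewrite raddf0 mul0rn.
Qed.

Lemma homology_eq0 p (x : homology X G p.+1) : x = 0.
Proof.
elim/quotW: x => z; rewrite -[0](raddf0 (\pi_(homology X G p.+1))).
apply/eqP; rewrite -Quotient.idealrBE subr0 boundsE /=.
(* If p + 1 is odd every cycle bounds; if it is even the cycle itself is zero. *)
by case: (boolP (odd p)) => //= op; rewrite (even_cycle_eq0 z op).
Qed.

Definition coef0 (x : homology X G 0) : gelt G := coef (val (repr x)).

(** In degree 0 only the zero cycle bounds, so the chosen representative of the class of [z] is [z]
    itself. *)
Lemma coef0_pi (z : cycle X G 0) : coef0 (\pi_(homology X G 0) z) = coef (val z).
Proof.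
have : repr (\pi_(homology X G 0) z) - z \in @bounds N X G 0.
  by rewrite Quotient.idealrBE reprK.
by rewrite boundsE raddfB subr_eq0 => /eqP e; rewrite /coef0 e.
Qed.

Fact coef0_is_zmod_morphism : zmod_morphism coef0.
Proof.
move=> x y; elim/quotW: x => z; elim/quotW: y => w.
by rewrite -raddfB !coef0_pi !raddfB.
Qed.
HB.instance Definition _ :=
  GRing.isZmodMorphism.Build (homology X G 0) (gelt G) coef0
    coef0_is_zmod_morphism.

Fact const_cycle_subproof (g : gelt G) : const_chain 0 g \in @cycle_pred N X G 0.
Proof. exact/asboolP/microchainT. Qed.

Lemma coef0_bij : bijective coef0.
Proof.
exists (fun g => \pi_(homology X G 0) (Cycle (const_cycle_subproof g))).
  move=> x; elim/quotW: x => z; rewrite coef0_pi; congr (\pi_(homology X G 0) _).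
  by apply: val_inj; rewrite /= coefK.
by move=> g; rewrite coef0_pi.
Qed.

End OnePoint.

Theorem proposition4 (N : nsUniverse) (X : uniformSpace (std N))
    (G : intAbGroup (nst N)) (hX : one_point X) :
  (exists f : {additive homology X G 0 -> gelt G}, bijective f) /\
  (forall p : int, p != 0 -> forall x : homology X G p, x = 0).
Proof.
split; first by exists (@coef0 N X G hX); exact: coef0_bij.
(* Degree 0 contradicts the hypothesis; in negative degrees the group consists of row vectors of
   length 0. *)
by move=> [[|p]|p] // _ x; [exact: homology_eq0|exact: thinmx0].
Qed.
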